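(* Let $G=(V,E)$ be a graph with $n=|V|$ vertices, let $C\in\mathbb{R}^{n\times n}$ be a matrix representing the distance between the vertices of $G$, let $w:\mathbb{R}\to\mathbb{R}$ be a window function with $\operatorname{supp}(w)=[-1,1]$, let $l>0$, and put $w_l(x)=w(x/l)$. Let $B\in\mathbb{R}^{n\times n}$ be the base window matrix obtained from the matrix with entries $w_l(C_{i,j})$ by normalizing its rows to sum to $1$, that is, $$B_{i,j}=\frac{w_l(C_{i,j})}{\sum_{k=1}^n w_l(C_{i,k})},$$ and let $W=BB$. Let $s_0\in\mathbb{R}^n$ and define $s_{m+1}=s_m-Ws_m$ for all $m\ge0$. Then the sequence $\{s_m\}$ converges as $m\to\infty$ to $$s_\infty = QDQ^Ts_0,$$ where $Q$ is an orthogonal matrix such that $W=Q\Lambda Q^T$ with $\Lambda$ a diagonal matrix, and $D$ is the diagonal matrix defined by $$D_{i,i}=\begin{cases}1 & \text{if } \lambda_i=\Lambda_{i,i}=0,\\ 0 & \text{otherwise.}\end{cases}$$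
   Context: The recursion $s_{m+1}=s_m-Ws_m$ is the inner loop of the Distance Based Iterative Filtering (DB-IF) algorithm, run indefinitely. Signals $s:V\to\mathbb{R}$ on the vertex set are identified with vectors in $\mathbb{R}^n$. The entry $C_{i,j}$ represents some kind of distance between the vertices $i$ and $j$ (for example the shortest path distance in a weighted graph, or the Euclidean distance when the vertices are points of a Euclidean space); no further axioms are stated for $C$. The number $l$ is the filter window length. A window function is a function $w:\mathbb{R}\to\mathbb{R}$ that is nonnegative, even, continuous, compactly supported, and has integral $1$.
   Formalization: C is assumed symmetric (the claim fails otherwise), and since W need not be orthogonally diagonalizable, convergence is proved always but the limit QDQ^T s_0 only for every orthogonal Q and diagonal Λ with W=QΛQ^T; existence of Q is not asserted. *)

(* Defs.v *)
From mathcomp Require Export all_boot all_order all_algebra.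
From mathcomp Require Export all_classical all_reals all_analysis.

Set Implicit Arguments.
Unset Strict Implicit.
Unset Printing Implicit Defensive.

Import Order.TTheory GRing.Theory Num.Theory.
Import numFieldNormedType.Exports.

Local Open Scope classical_set_scope.
Local Open Scope ring_scope.

Definition supp (R : realType) (w : R -> R) : set R :=
  closure [set x | w x != 0].

Record window_function (R : realType) (w : R -> R) : Prop := {
  window_ge0 : forall x, 0 <= w x ;
  window_even : forall x, w (- x) = w x ;
  window_continuous : continuous w ;
  window_compact_supp : compact (supp w) ;
  window_integral1 : (\int[@lebesgue_measure R]_x (w x)%:E = 1)%E
}.

Definition scaled_window (R : realType) (w : R -> R) (l x : R) : R := w (x / l).

(* A row whose sum is 0 cannot be normalized; as y / 0 = 0 it is left zero. *)
Definition base_window_mx (R : realType) (n : nat) (C : 'M[R]_n)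
    (w : R -> R) (l : R) : 'M[R]_n :=
  \matrix_(i, j) (scaled_window w l (C i j)
                  / \sum_k scaled_window w l (C i k)).

Definition filter_mx (R : realType) (n : nat) (C : 'M[R]_n)
    (w : R -> R) (l : R) : 'M[R]_n :=
  base_window_mx C w l *m base_window_mx C w l.

Fixpoint filtering_seq (R : realType) (n : nat) (W : 'M[R]_n) (s0 : 'cV[R]_n)
    (m : nat) : 'cV[R]_n :=
  if m is m'.+1
  then filtering_seq W s0 m' - W *m filtering_seq W s0 m'
  else s0.

Definition orthogonal_mx (R : realType) (n : nat) (Q : 'M[R]_n) : Prop :=
  Q *m Q^T = 1%:M /\ Q^T *m Q = 1%:M.

Definition zero_eigen_mx (R : realType) (n : nat) (Lambda : 'M[R]_n) :
    'M[R]_n :=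
  \matrix_(i, j) (if (i == j) && (Lambda i i == 0) then 1 else 0).

(* Main.v *)
(**
Let d_i be the row sums of the symmetric nonnegative matrix w_l(C). For the
semi-inner product <x, y> = sum_i d_i x_i y_i, the matrix B is self-adjoint and,
by Jensen's inequality, a contraction; rows with d_i = 0 vanish.

No diagonalization is needed for convergence. As I - W is self-adjoint,
<s_m, s_k> = a_(m+k) with a_k = <s_0, s_k>, and a is nonincreasing and
nonnegative, hence convergent. Then |s_m - s_k|^2 = a_(2m) - 2 a_(m+k) + a_(2k)
makes every coordinate with d_i > 0 Cauchy, while the others are constant.

If W = Q Lambda Q^T, then lambda <v, v> = |Bv|^2 <= |v|^2 for an eigenvector v
puts the eigenvalues in [0, 1], so (1 - lambda)^m tends to 1 if lambda = 0 and
to 0 otherwise.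
*)
Require Import Defs.
From mathcomp Require Import ring lra.

Set Implicit Arguments.
Unset Strict Implicit.
Unset Printing Implicit Defensive.

Import Order.TTheory GRing.Theory Num.Theory.
Import numFieldNormedType.Exports.

Local Open Scope classical_set_scope.
Local Open Scope ring_scope.

Definition weighted_dot (R : realType) (n : nat) (d : 'I_n -> R)
    (x y : 'cV[R]_n) : R :=
  \sum_i d i * x i 0 * y i 0.

(** Entrywise form of self-adjointness: the detailed balance condition. *)
Definition weighted_selfadjoint (R : realType) (n : nat) (d : 'I_n -> R)
    (B : 'M[R]_n) : Prop :=
  forall i j, d i * B i j = d j * B j i.

Definition weighted_contraction (R : realType) (n : nat) (d : 'I_n -> R)
    (B : 'M[R]_n) : Prop :=
  forall x, weighted_dot d (B *m x) (B *m x) <= weighted_dot d x x.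

(** * The limit computed in an eigenbasis *)

Lemma cvg_mx_entries (R : realType) (m n : nat) (u : nat -> 'M[R]_(m, n))
    (A : 'M[R]_(m, n)) :
  (forall i j, u k i j @[k --> \oo] --> A i j) -> u k @[k --> \oo] --> A.
Proof.
move=> uA; apply/cvg_mx_entourageP => E entE.
suff H : \forall k \near \oo, forall ij : 'I_m * 'I_n,
    (A ij.1 ij.2, u k ij.1 ij.2) \in E.
  by apply: filterS H => k Hk i j; exact: (Hk (i, j)).
apply: filter_forall => -[i j] /=.
move/cvg_app_entourageP: (uA i j) => /(_ E entE).
by apply: filterS => k; rewrite inE.
Qed.

Lemma filtering_seq_diag (R : realType) (n : nat) (W Q : 'M[R]_n)
    (lam : 'rV[R]_n) (s0 : 'cV[R]_n) (m : nat) (i : 'I_n) :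
  Q^T *m Q = 1%:M -> W = Q *m diag_mx lam *m Q^T ->
  (Q^T *m filtering_seq W s0 m) i 0 = (1 - lam 0 i) ^+ m * (Q^T *m s0) i 0.
Proof.
move=> QQ WE; elim: m => [|m IH] /=; first by rewrite expr0 mul1r.
rewrite mulmxBr mulmxA [X in _ - X *m _](_ : _ = diag_mx lam *m Q^T); last first.
  by rewrite WE !mulmxA QQ mul1mx.
rewrite -mulmxA mul_diag_mx mxE [X in _ + X]mxE [X in _ - X]mxE IH exprS; ring.
Qed.

Lemma cvg_filtering_seq_diag (R : realType) (n : nat) (W Q : 'M[R]_n)
    (lam : 'rV[R]_n) (s0 : 'cV[R]_n) :
  orthogonal_mx Q -> W = Q *m diag_mx lam *m Q^T ->
  (forall i, 0 <= lam 0 i <= 1) ->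
  filtering_seq W s0 m @[m --> \oo]
    --> Q *m zero_eigen_mx (diag_mx lam) *m Q^T *m s0.
Proof.
move=> [QQ' QQ] WE lam01; apply: cvg_mx_entries => i j.
rewrite (ord1 j) -!mulmxA mxE.
(* Writing [s_m] as [Q (Q^T s_m)] leaves only the scalar limits of [(1 - lam 0 k) ^+ m]. *)
have -> : (fun m => filtering_seq W s0 m i 0) =
    (fun m => \sum_k Q i k * ((1 - lam 0 k) ^+ m * (Q^T *m s0) k 0)).
  apply/funext => m; rewrite -[filtering_seq _ _ _]mul1mx -QQ' -mulmxA mxE.
  by apply: eq_bigr => k _; rewrite (filtering_seq_diag _ _ _ QQ WE).
apply: cvg_big => [|k _]; first exact: add_continuous.
apply: cvgMl_tmp.
have -> : (zero_eigen_mx (diag_mx lam) *m (Q^T *m s0)) k 0 =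
    (lam 0 k == 0)%:R * (Q^T *m s0) k 0.
  rewrite mxE (bigD1 k) //= big1 ?addr0 => [|a ak]; last first.
    by rewrite mxE eq_sym (negPf ak) /= mul0r.
  by rewrite !mxE eqxx mulr1n; case: eqP.
apply: cvgMr_tmp; have [->|lam0] := eqVneq (lam 0 k) 0.
  rewrite subr0; under eq_cvg do rewrite expr1n; exact: cvg_cst.
apply: cvg_expr; have /andP[l0 l1] := lam01 k.
by rewrite ger0_norm ?subr_ge0// ltrBlDr ltrDl lt_def lam0.
Qed.

(** * Convergence for a self-adjoint contraction of a semi-inner product *)

Section WeightedDot.
Context (R : realType) (n : nat) (d : 'I_n -> R).
Implicit Types (x y z : 'cV[R]_n) (B : 'M[R]_n).
Local Notation dot := (weighted_dot d).

Lemma weighted_dotC x y : dot x y = dot y x.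
Proof. by apply: eq_bigr => i _; ring. Qed.

Lemma weighted_dotBr x y z : dot x (y - z) = dot x y - dot x z.
Proof. by rewrite -sumrB; apply: eq_bigr => i _; rewrite !mxE; ring. Qed.

Lemma weighted_dotBl x y z : dot (x - y) z = dot x z - dot y z.
Proof. by rewrite weighted_dotC weighted_dotBr !(weighted_dotC z). Qed.

Lemma weighted_dotZr a x y : dot x (a *: y) = a * dot x y.
Proof. by rewrite mulr_sumr; apply: eq_bigr => i _; rewrite !mxE; ring. Qed.

Lemma weighted_dot_mulmx B x y : weighted_selfadjoint d B ->
  dot (B *m x) y = dot x (B *m y).
Proof.
move=> adjB; transitivity (\sum_i \sum_j d i * B i j * x j 0 * y i 0).
  apply: eq_bigr => i _; rewrite mxE mulr_sumr mulr_suml.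
  by apply: eq_bigr => j _; ring.
rewrite exchange_big; apply: eq_bigr => i _; rewrite mxE mulr_sumr.
by apply: eq_bigr => j _; rewrite adjB; ring.
Qed.

Hypothesis d_ge0 : forall i, 0 <= d i.

Lemma weighted_dot_ge_coord x i : d i * x i 0 ^+ 2 <= dot x x.
Proof.
rewrite /weighted_dot (bigD1 i) //= expr2 mulrA lerDl sumr_ge0 // => j _.
by rewrite -mulrA mulr_ge0 // -expr2 sqr_ge0.
Qed.

Lemma weighted_dot_ge0 x : 0 <= dot x x.
Proof.
by apply: sumr_ge0 => i _; rewrite -mulrA mulr_ge0 // -expr2 sqr_ge0.
Qed.

Variable B : 'M[R]_n.
Hypothesis adjB : weighted_selfadjoint d B.
Hypothesis contrB : weighted_contraction d B.
Hypothesis degB : forall i j, d i = 0 -> B i j = 0.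

Lemma weighted_dot_sqr x y : dot x (B *m B *m y) = dot (B *m x) (B *m y).
Proof. by rewrite -mulmxA weighted_dot_mulmx. Qed.

Lemma eigenvalue_sqr_itv (v : 'cV[R]_n) (lambda : R) :
  v != 0 -> B *m B *m v = lambda *: v -> 0 <= lambda <= 1.
Proof.
move=> v0 Wv.
have E : lambda * dot v v = dot (B *m v) (B *m v).
  by rewrite -weighted_dot_sqr Wv weighted_dotZr.
have := weighted_dot_ge0 v; rewrite le_eqVlt => /orP[/eqP vv0|vv0].
  (* [v] lives on the vertices of degree 0, where the columns of [B] vanish too. *)
  have dv i : d i = 0 \/ v i 0 = 0.
    have := weighted_dot_ge_coord v i; rewrite -vv0 => h.
    have /eqP : d i * v i 0 ^+ 2 = 0.
      by apply/eqP; rewrite eq_le h mulr_ge0 // sqr_ge0.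
    by rewrite mulf_eq0 sqrf_eq0 => /orP[]/eqP; [left|right].
  have Bv : B *m v = 0.
    apply/colP => i; rewrite !mxE big1 // => j _.
    have [dj|->] := dv j; last by rewrite mulr0.
    (* Row [i] vanishes if [d i = 0]; otherwise self-adjointness gives [d i * B i j = 0]. *)
    have [di|di] := eqVneq (d i) 0; first by rewrite degB ?mul0r.
    have /eqP := adjB i j; rewrite dj mul0r mulf_eq0 (negPf di) /= => /eqP ->.
    by rewrite mul0r.
  move: Wv; rewrite -mulmxA Bv mulmx0 => /esym/eqP.
  by rewrite scaler_eq0 (negPf v0) orbF => /eqP ->; rewrite lexx ler01.
rewrite -(pmulr_lge0 _ vv0) E weighted_dot_ge0 /=.
by rewrite -(ler_pM2r vv0) E mul1r.
Qed.

Local Notation s := (filtering_seq (B *m B)).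

(** Each factor [I - W] moves from the left argument to the right one. *)
Lemma filtering_dot_shift s0 m k : dot (s s0 m) (s s0 k) = dot s0 (s s0 (m + k)).
Proof.
elim: m k => [//|m IH] k; rewrite addSnnS -IH /= weighted_dotBl weighted_dotBr.
by rewrite (weighted_dotC (B *m B *m _)) !weighted_dot_sqr (weighted_dotC (B *m _)).
Qed.

(* With [x := s s0 k], the dot product at index [2k] is [|x|^2], at [2k + 1] it is
   [|x|^2 - |Bx|^2], and at [2k + 2] it is [|x|^2 - 2 |Bx|^2 + |B(Bx)|^2]. *)
Lemma filtering_dot_nonincreasing s0 :
  nonincreasing_seq (fun k => dot s0 (s s0 k)).
Proof.
apply/nonincreasing_seqP => k; rewrite -(odd_double_half k) -addnn.
case: (odd k); rewrite ?add0n ?add1n.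
  (* From an odd index the drop is [|Bx|^2 - |B(Bx)|^2], nonnegative by contraction; from an even
     one it is [|Bx|^2]. *)
  rewrite -[X in X.+1]addnS -addSn -[X in _ <= dot _ (s _ X)]addnS -!filtering_dot_shift /=.
  set x := filtering_seq _ _ _; rewrite !(weighted_dotBl, weighted_dotBr).
  rewrite (weighted_dotC (B *m B *m x) x) !(weighted_dot_sqr x).
  have := contrB (B *m x); rewrite mulmxA; lra.
rewrite -addnS -!filtering_dot_shift /= weighted_dotBr weighted_dot_sqr.
by rewrite gerBl weighted_dot_ge0.
Qed.

Lemma is_cvg_filtering_dot s0 : cvgn (fun k => dot s0 (s s0 k)).
Proof.
apply: nonincreasing_is_cvgn; first exact: filtering_dot_nonincreasing.
exists 0 => _ [k _ <-].
(* The term at [k] is at least the one at [k + k], which is [|s_k|^2]. *)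
apply: le_trans (filtering_dot_nonincreasing s0 (leq_addr k k)).
by rewrite -filtering_dot_shift weighted_dot_ge0.
Qed.

Lemma is_cvg_filtering_coord s0 i : cvgn (fun k => s s0 k i 0).
Proof.
have [di|di] := eqVneq (d i) 0.
  suff -> : (fun k => s s0 k i 0) = cst (s0 i 0) by exact: is_cvg_cst.
  apply/funext; elim=> //= k IH.
  rewrite mxE IH -mulmxA 2!mxE big1 ?subr0 // => j _.
  by rewrite degB ?mul0r.
have {di}di : 0 < d i by rewrite lt_def di d_ge0.
have ninc := @filtering_dot_nonincreasing s0.
have acvg := @is_cvg_filtering_dot s0.
have age := nonincreasing_cvgn_ge ninc acvg.
set a := (fun k => dot s0 (s s0 k)) in ninc acvg age.
apply/cauchy_cvgP/cauchy_exP => e e0.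
(* A squared seminorm below [d i * e ^+ 2] puts coordinate [i] within [e]. *)
have de : 0 < d i * e ^+ 2 by rewrite mulr_gt0 // exprn_gt0.
have /cvgrPdist_lt/(_ _ de)[N _ aN] := acvg.
exists (s s0 N i 0); exists N => // m /= Nm.
rewrite /ball /= -(ltr_pXn2r (n := 2)) ?nnegrE ?normr_ge0 ?(ltW e0) //.
rewrite real_normK ?num_real // -(ltr_pM2l di).
have := weighted_dot_ge_coord (s s0 N - s s0 m) i.
rewrite [X in d i * X ^+ 2]mxE [X in d i * (_ + X) ^+ 2]mxE => /le_lt_trans.
apply.
rewrite !(weighted_dotBl, weighted_dotBr) (weighted_dotC (s s0 m) (s s0 N)).
rewrite !filtering_dot_shift -!/(a _).
(* As [N <= m], [a (m + m) <= a (N + m)], so the squared distance is at most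
   [a (N + N) - a (N + m)], hence at most [a (N + N) - lim a]. *)
have := aN (N + N)%N (leq_addr _ _); rewrite /= distrC.
rewrite ger0_norm ?subr_ge0; last exact: age.
have := age (N + m)%N; rewrite -/(a _).
have : a (m + m)%N <= a (N + m)%N by apply: ninc; rewrite leq_add2r.
lra.
Qed.

Lemma is_cvg_filtering_seq s0 : cvg (s s0 k @[k --> \oo]).
Proof.
apply/cvg_ex; exists (\col_i limn (fun k => s s0 k i 0)).
apply: cvg_mx_entries => i j; rewrite (ord1 j) mxE.
exact: is_cvg_filtering_coord.
Qed.

End WeightedDot.

(** * The base window matrix as such a contraction *)

Section BaseWindow.
Context (R : realType) (n : nat) (C : 'M[R]_n) (w : R -> R) (l : R).
Hypothesis symC : forall i j, C i j = C j i.
Hypothesis w_ge0 : forall x, 0 <= w x.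

Definition window_degree (i : 'I_n) : R := \sum_k scaled_window w l (C i k).

Local Notation d := window_degree.
Local Notation B := (base_window_mx C w l).

Lemma window_degree_ge0 i : 0 <= d i.
Proof. by apply: sumr_ge0 => k _; exact: w_ge0. Qed.

(** Normalization can be undone even in a row of sum 0, since its nonnegative weights then all
    vanish. *)
Lemma window_degree_base i j : d i * B i j = scaled_window w l (C i j).
Proof.
rewrite mxE -/(d i); have [d0|d0] := eqVneq (d i) 0; last by rewrite mulrC divfK.
rewrite d0 mul0r; move/eqP: d0.
rewrite psumr_eq0 => [|k _]; last exact: w_ge0.
by move/allP/(_ j (mem_index_enum j))/eqP.
Qed.

Lemma base_window_selfadjoint : weighted_selfadjoint d B.
Proof. by move=> i j; rewrite !window_degree_base symC. Qed.

Lemma base_window_degenerate i j : d i = 0 -> B i j = 0.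
Proof. by move=> d0; rewrite mxE -/(d i) d0 invr0 mulr0. Qed.

(* Jensen's inequality, as the nonnegativity of the variance of [x] in each row. *)
Lemma base_window_contraction : weighted_contraction d B.
Proof.
(* By symmetry [d j] is also a column sum, so [|x|^2] splits over the rows and the bound is proved
   row by row. *)
move=> x; have -> : weighted_dot d x x =
    \sum_i \sum_j scaled_window w l (C i j) * x j 0 ^+ 2.
  rewrite exchange_big; apply: eq_bigr => j _ /=.
  rewrite -mulrA -expr2 mulr_suml.
  by apply: eq_bigr => i _; rewrite symC.
apply: ler_sum => i _; pose y : R := (B *m x) i 0.
rewrite -[X in _ * X * _]/y -[X in _ * _ * X]/y.
have yE : \sum_j scaled_window w l (C i j) * x j 0 = d i * y.
  rewrite /y mxE mulr_sumr; apply: eq_bigr => j _.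
  by rewrite mulrA window_degree_base.
have : 0 <= \sum_j scaled_window w l (C i j) * (x j 0 - y) ^+ 2.
  by apply: sumr_ge0 => j _; rewrite mulr_ge0 ?sqr_ge0 // w_ge0.
have -> : \sum_j scaled_window w l (C i j) * (x j 0 - y) ^+ 2 =
    \sum_j scaled_window w l (C i j) * x j 0 ^+ 2 - 2 * y * (d i * y)
    + d i * y ^+ 2.
  rewrite -yE mulr_sumr mulr_suml -sumrB -big_split /=.
  by apply: eq_bigr => j _; ring.
rewrite expr2 mulrA; lra.
Qed.

End BaseWindow.

Theorem theorem3 (R : realType) (V : finType) (E : rel V)
    (C : 'M[R]_#|V|) (w : R -> R) (l : R) (s0 : 'cV[R]_#|V|)
    (hC : forall i j, C i j = C j i)
    (hw : window_function w) (hsupp : supp w = `[-1, 1]%classic) (hl : 0 < l) :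
  cvg (filtering_seq (filter_mx C w l) s0 m @[m --> \oo]) /\
  forall Q Lambda : 'M[R]_#|V|,
    orthogonal_mx Q -> is_diag_mx Lambda ->
    filter_mx C w l = Q *m Lambda *m Q^T ->
    filtering_seq (filter_mx C w l) s0 m @[m --> \oo]
      --> Q *m zero_eigen_mx Lambda *m Q^T *m s0.
Proof.
have w0 := window_ge0 hw.
have d0 := window_degree_ge0 C l w0.
have adjB := base_window_selfadjoint l hC w0.
have contrB := base_window_contraction l hC w0.
have degB := @base_window_degenerate R _ C w l.
split; first exact: (is_cvg_filtering_seq d0 adjB contrB degB).
move=> Q Lambda Qorth /diag_mxP[lam ->] WE.
apply: (@cvg_filtering_seq_diag R _ _ Q lam s0 Qorth WE) => i.
have [_ QQ] := Qorth.
(* Column [i] of [Q] is an eigenvector for [lam 0 i], nonzero because [(Q^T Q) i i = 1]. *)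
apply: (eigenvalue_sqr_itv d0 adjB contrB degB (v := col i Q)).
  apply/eqP => Q0; have /matrixP/(_ i i) := QQ.
  rewrite !mxE eqxx big1 => [/esym/eqP|j _]; first by rewrite oner_eq0.
  by have /colP/(_ j) := Q0; rewrite !mxE => ->; rewrite mulr0.
rewrite -/(filter_mx C w l) colE mulmxA WE -[_ *m Q^T *m Q]mulmxA QQ mulmx1 -!colE.
by apply/colP => j; rewrite mul_mx_diag !mxE mulrC.
Qed.
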